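(* Let $n\in\{0,1,2,\dots\}$ and $\delta\in(0,n+1)$. Then for every $s>0$ $$\frac{d}{ds}\bigl[E_{n,\delta}(s)\bigr]=0\iff e^s=1+\frac{s^1}{1!}+\dots+\frac{s^n}{n!}+\frac{1}{\delta}\,\frac{s^{n+1}}{n!},$$ and the equation $$e^s=1+\frac{s^1}{1!}+\dots+\frac{s^n}{n!}+\frac{1}{\delta}\,\frac{s^{n+1}}{n!}$$ has exactly one positive solution $s>0$.
   Context: For $n\in\{0,1,2,\dots\}$, $\delta\in(0,n+1)$ and $s>0$, $$E_{n,\delta}(s)=\frac{1-\Bigl(1+\frac{s^1}{1!}+\dots+\frac{s^n}{n!}\Bigr)e^{-s}}{s^{\delta}}.$$ *)

(* Defs.v *)
From Stdlib Require Import Reals Factorial.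
From Coquelicot Require Import Coquelicot.
Open Scope R_scope.

(* [sum_f_R0 f n] has n+1 terms, for k = 0, ..., n. *)
Definition exp_partial (n : nat) (s : R) : R :=
  sum_f_R0 (fun k => s ^ k / INR (fact k)) n.

(* Meaningful for 0 < s only: [Rpower s delta] is [exp (delta * ln s)]. *)
Definition E (n : nat) (delta s : R) : R :=
  (1 - exp_partial n s * exp (- s)) / Rpower s delta.

Definition critical_eq (n : nat) (delta s : R) : Prop :=
  exp s = exp_partial n s + 1 / delta * (s ^ S n / INR (fact n)).

(* Main.v *)
Require Import Defs.
From Stdlib Require Import Reals Factorial Lra Lia.
From Coquelicot Require Import Coquelicot.
Open Scope R_scope.

(** Write [P] for the Taylor polynomial [exp_partial n].  Both halves of the
    result concern the zeros on [s > 0] of the single function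
    [e^s - P s - c * s ^ (n + 1)], taken at [c = 1 / (delta * n!)].

    The derivative of the numerator [1 - P s * e^(-s)] telescopes to
    [e^(-s) * s ^ n / n!], because [P - P'] is the top monomial of [P].
    The quotient rule then gives
    [E' s = - delta * e^(-s) / (s * s^delta) * (e^s - P s - c * s ^ (n + 1))],
    with a prefactor that never vanishes ([is_derive_E]).

    For the number of zeros, consider all orders at once:
    [gap m c s = e^s - (Taylor polynomial of degree < m) - c * s ^ m].
    Differentiating [gap (m + 1) c] yields [gap m ((m + 1) * c)], and the
    condition [c > 1 / m!] is carried along by this change of [c].  Under it,
    [gap m c] is negative up to some point and positive after it
    ([gap_crosses_zero]).  For [m = 0] this is the monotonicity of
    [e^s - c] with [c > 1].  In the step, [gap (m + 1) c] vanishes at [0],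
    decreases, then increases, and is positive somewhere since
    the Taylor polynomial of degree [m + 2] lies below [e^s]; such a function
    changes sign exactly once ([crosses_zero_of_derivative]).  The hypothesis
    [delta < n + 1] says exactly that [1 / (delta * n!) > 1 / (n + 1)!]. *)

(** * Sign changes on the positive half-line *)

Definition crosses_zero_at (f : R -> R) (r : R) : Prop :=
  0 < r /\ f r = 0 /\
  (forall s, 0 < s < r -> f s < 0) /\ (forall s, r < s -> 0 < f s).

Lemma crosses_zero_unique (f : R -> R) (r s : R) :
  crosses_zero_at f r -> 0 < s -> f s = 0 -> s = r.
Proof.
  intros (_ & _ & Hneg & Hpos) Hs Hfs.
  destruct (Rtotal_order s r) as [Hlt | [-> | Hgt]].
  - specialize (Hneg s (conj Hs Hlt)); lra.
  - reflexivity.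
  - specialize (Hpos s Hgt); lra.
Qed.

(** [f] first decreases from [0] and then increases, so it stays negative on
    the decreasing part and can cross zero only on the increasing part.  The
    point [M] is what forces the crossing to happen. *)
Lemma crosses_zero_of_derivative (f f' : R -> R) (r M : R) :
  (forall s, is_derive f s (f' s)) -> f 0 = 0 ->
  crosses_zero_at f' r -> 0 < M -> 0 < f M ->
  exists x, crosses_zero_at f x.
Proof.
  intros Hder Hf0 (Hr & _ & Hneg & Hpos) HM HfM.
  assert (Hmvt : forall a b, a < b ->
            exists c, f b - f a = f' c * (b - a) /\ a < c < b).
  { intros a b Hab; apply MVT_cor2; [exact Hab |].
    intros c _; apply is_derive_Reals, Hder. }
  assert (Hlow : forall s, 0 < s <= r -> f s < 0).
  { intros s Hs; destruct (Hmvt 0 s) as (c & Hc & Hcs); [lra |].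
    assert (f' c < 0) by (apply Hneg; lra).
    nra. }
  assert (Hincr : forall a b, r <= a -> a < b -> f a < f b).
  { intros a b Ha Hab; destruct (Hmvt a b Hab) as (c & Hc & Hcab).
    assert (0 < f' c) by (apply Hpos; lra).
    nra. }
  assert (HrM : r < M).
  { destruct (Rlt_le_dec r M) as [H | H]; [exact H |].
    specialize (Hlow M (conj HM H)); lra. }
  destruct (IVT f r M) as (x & Hx & Hfx); try assumption.
  { intros s; apply derivable_continuous_pt.
    exists (f' s); apply is_derive_Reals, Hder. }
  { apply Hlow; lra. }
  exists x; repeat split; try assumption; try lra.
  - intros s Hs; destruct (Rle_lt_dec s r) as [Hsr | Hsr].
    + apply Hlow; lra.
    + rewrite <- Hfx; apply Hincr; lra.
  - intros s Hs; rewrite <- Hfx; apply Hincr; lra.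
Qed.

(** * Taylor polynomials of the exponential *)

(** The Taylor polynomial of degree strictly less than [n].  Shifting the
    index makes the zero polynomial available as the case [n = 0], which is
    where the induction on the order starts. *)
Definition exp_partial_lt (n : nat) (s : R) : R :=
  match n with
  | O => 0
  | S m => exp_partial m s
  end.

Lemma exp_partial_split (n : nat) (s : R) :
  exp_partial n s = exp_partial_lt n s + s ^ n / INR (fact n).
Proof.
  destruct n as [| n]; simpl.
  - unfold exp_partial; simpl; lra.
  - reflexivity.
Qed.

Lemma INR_fact_S (n : nat) :
  INR (fact (S n)) = (INR n + 1) * INR (fact n).
Proof. rewrite fact_simpl, mult_INR, S_INR; reflexivity. Qed.

Lemma exp_partial_at_0 (n : nat) : exp_partial n 0 = 1.
Proof.
  induction n as [| n IH].
  - unfold exp_partial; simpl; lra.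
  - rewrite exp_partial_split; simpl exp_partial_lt.
    rewrite IH, pow_i by lia; unfold Rdiv; ring.
Qed.

Lemma is_derive_exp_partial (n : nat) (s : R) :
  is_derive (exp_partial n) s (exp_partial_lt n s).
Proof.
  induction n as [| n IH].
  - apply is_derive_ext with (fun _ => 1).
    + intros t; unfold exp_partial; simpl; lra.
    + apply is_derive_Reals, derivable_pt_lim_const.
  - apply is_derive_ext with
      (fun t => exp_partial n t + t ^ S n / INR (fact (S n))).
    + reflexivity.
    + simpl exp_partial_lt; rewrite (exp_partial_split n s).
      refine (is_derive_plus _ _ _ _ _ _ _); [exact IH |].
      pose proof (INR_fact_neq_0 n).
      pose proof (pos_INR n).
      rewrite INR_fact_S.
      auto_derive; [exact I |].
      change (Nat.pred (S n)) with n.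
      change (match n with O => 1 | S _ => INR n + 1 end) with (INR (S n)).
      rewrite S_INR; field; split; [assumption | lra].
Qed.

(** * The Taylor remainder against a monomial *)

Definition gap (n : nat) (c s : R) : R :=
  exp s - exp_partial_lt n s - c * s ^ n.

Lemma is_derive_gap_S (n : nat) (c s : R) :
  is_derive (gap (S n) c) s (gap n (c * (INR n + 1)) s).
Proof.
  unfold gap; simpl exp_partial_lt.
  refine (is_derive_minus _ _ _ _ _ _ _).
  - refine (is_derive_minus _ _ _ _ _ _ _); [| apply is_derive_exp_partial].
    apply is_derive_Reals, derivable_pt_lim_exp.
  - auto_derive; [exact I |].
    change (Nat.pred (S n)) with n.
    change (match n with O => 1 | S _ => INR n + 1 end) with (INR (S n)).
    rewrite S_INR; ring.
Qed.

Lemma gap_S_at_0 (n : nat) (c : R) : gap (S n) c 0 = 0.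
Proof.
  unfold gap; simpl exp_partial_lt.
  rewrite exp_0, exp_partial_at_0, pow_i by lia; ring.
Qed.

Lemma gap_positive_somewhere (n : nat) (c : R) :
  0 < c -> exists M, 0 < M /\ 0 < gap n c M.
Proof.
  intros Hc.
  pose proof (INR_fact_lt_0 n) as Hn.
  pose proof (INR_fact_lt_0 (S n)) as HSn.
  (* At this point the Taylor term of degree [n + 1] equals [c * M ^ n], and
     the term of degree [n] is left over. *)
  set (M := c * INR (fact (S n))).
  assert (HM : 0 < M) by (unfold M; nra).
  exists M; split; [exact HM |].
  assert (Hexp : exp_partial (S n) M <= exp M) by (apply exp_ge_taylor; lra).
  rewrite exp_partial_split in Hexp; simpl exp_partial_lt in Hexp.
  rewrite exp_partial_split in Hexp.
  assert (Htop : M ^ S n / INR (fact (S n)) = c * M ^ n).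
  { rewrite <- tech_pow_Rmult; unfold M at 1; field; lra. }
  assert (0 < M ^ n / INR (fact n)).
  { apply Rdiv_lt_0_compat; [apply pow_lt |]; assumption. }
  unfold gap; lra.
Qed.

(** The threshold [1 / n!] is the Taylor coefficient of degree [n]: above it,
    the monomial [c * s ^ n] dominates the remainder for small [s], while the
    exponential dominates for large [s]. *)
Lemma gap_crosses_zero (n : nat) : forall c : R,
  1 < c * INR (fact n) -> exists r, crosses_zero_at (gap n c) r.
Proof.
  induction n as [| n IH]; intros c Hc.
  - simpl in Hc.
    assert (Hgap : forall s, gap 0 c s = exp s - c)
      by (intros s; unfold gap; simpl; ring).
    assert (Hln : exp (ln c) = c) by (apply exp_ln; lra).
    exists (ln c); repeat split.
    + rewrite <- ln_1; apply ln_increasing; lra.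
    + rewrite Hgap; lra.
    + intros s Hs; rewrite Hgap.
      assert (exp s < exp (ln c)) by (apply exp_increasing; lra); lra.
    + intros s Hs; rewrite Hgap.
      assert (exp (ln c) < exp s) by (apply exp_increasing; lra); lra.
  - pose proof (INR_fact_lt_0 (S n)) as HSn.
    destruct (gap_positive_somewhere (S n) c) as (M & HM & HgM); [nra |].
    rewrite INR_fact_S in Hc.
    destruct (IH (c * (INR n + 1))) as (r & Hr); [lra |].
    apply crosses_zero_of_derivative with (gap n (c * (INR n + 1))) r M;
      try assumption.
    + intros s; apply is_derive_gap_S.
    + apply gap_S_at_0.
Qed.

(** * The derivative of [E] and the critical equation *)

Lemma critical_eq_gap (n : nat) (delta s : R) :
  0 < delta ->
  critical_eq n delta s <-> gap (S n) (1 / (delta * INR (fact n))) s = 0.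
Proof.
  intros Hdelta; pose proof (INR_fact_neq_0 n).
  unfold critical_eq, gap; simpl exp_partial_lt.
  replace (1 / delta * (s ^ S n / INR (fact n)))
    with (1 / (delta * INR (fact n)) * s ^ S n)
    by (field; split; [assumption | lra]).
  split; intros; lra.
Qed.

Lemma is_derive_exp_remainder (n : nat) (s : R) :
  is_derive (fun t => 1 - exp_partial n t * exp (- t)) s
    (s ^ n / INR (fact n) * exp (- s)).
Proof.
  pose proof (is_derive_exp_partial n s) as HP.
  auto_derive.
  - exists (exp_partial_lt n s); exact HP.
  - assert (HD : Derive (fun x : R => exp_partial n x) s = exp_partial_lt n s)
      by apply is_derive_unique, HP.
    rewrite HD, (exp_partial_split n s); ring.
Qed.

Lemma is_derive_E (n : nat) (delta s : R) :
  0 < delta -> 0 < s ->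
  is_derive (E n delta) s
    (- (delta * exp (- s) / (s * Rpower s delta))
     * gap (S n) (1 / (delta * INR (fact n))) s).
Proof.
  intros Hdelta Hs.
  pose proof (INR_fact_neq_0 n) as Hn.
  assert (Hpow : 0 < Rpower s delta) by apply exp_pos.
  assert (HR : is_derive (fun t => Rpower t delta) s
                 (delta * Rpower s delta / s)).
  { unfold Rpower; auto_derive; [exact Hs |]; field; lra. }
  pose proof (is_derive_div _ _ s _ _ (is_derive_exp_remainder n s) HR
                (Rgt_not_eq _ _ Hpow)) as Hquot.
  refine (@eq_ind R _ (is_derive (E n delta) s) Hquot _ _).
  pose proof (exp_pos s) as Hpos.
  cbv beta; unfold gap; simpl exp_partial_lt; rewrite exp_Ropp.
  change (s ^ S n) with (s * s ^ n).
  field; repeat split; lra.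
Qed.

Theorem proposition1 (n : nat) (delta : R)
    (hdelta : 0 < delta < INR n + 1) :
  (forall s : R, 0 < s ->
     ex_derive (E n delta) s /\
     (Derive (E n delta) s = 0 <-> critical_eq n delta s)) /\
  (exists! s : R, 0 < s /\ critical_eq n delta s).
Proof.
  destruct hdelta as [Hdelta Hlt].
  split.
  - intros s Hs.
    pose proof (is_derive_E n delta s Hdelta Hs) as HE.
    split; [eexists; exact HE |].
    rewrite (is_derive_unique _ _ _ HE), (critical_eq_gap n delta s Hdelta).
    assert (Hfactor : 0 < delta * exp (- s) / (s * Rpower s delta)).
    { apply Rdiv_lt_0_compat; apply Rmult_lt_0_compat;
        try assumption; apply exp_pos. }
    split; intros H.
    + apply Rmult_integral in H; destruct H; [lra | assumption].
    + rewrite H; ring.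
  - destruct (gap_crosses_zero (S n) (1 / (delta * INR (fact n))))
      as (r & Hr).
    { pose proof (INR_fact_neq_0 n).
      rewrite INR_fact_S.
      replace (1 / (delta * INR (fact n)) * ((INR n + 1) * INR (fact n)))
        with ((INR n + 1) / delta) by (field; split; [assumption | lra]).
      apply Rmult_lt_reg_r with delta; [exact Hdelta |].
      unfold Rdiv; rewrite Rmult_assoc, Rinv_l; lra. }
    exists r; split.
    + destruct Hr as (Hpos & Hzero & _).
      split; [exact Hpos | apply critical_eq_gap; assumption].
    + intros s (Hs & Hcrit); symmetry.
      apply (crosses_zero_unique _ _ _ Hr Hs), critical_eq_gap; assumption.
Qed.
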